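(* Let $\ell\in(0,1]$, $\alpha\in(0,1)$ and set $u_\alpha=\left(\frac{\alpha}{1-\alpha}\right)^2\ell$. Let $c_{m,n}$ and $R_m=c_{m,m+1}/\alpha$ be as defined in the context. Then, for all integers $0\le m<n$, $$c_{m,n}=\alpha(1-\alpha)^{m+n-1}\Big(n\,F_1\big(1-n;-m,1;2;u_\alpha,-\tfrac{\alpha}{1-\alpha}\big)-m\,F_1\big(1-m;-n,1;2;u_\alpha,-\tfrac{\alpha}{1-\alpha}\big)\Big),$$ $$R_m=(1-\alpha)^{2m}\,F_1\big(-m;-(m+1),2;2;u_\alpha,-\tfrac{\alpha}{1-\alpha}\big).$$ (For $m=0$ the second term in the formula for $c_{m,n}$ is taken to be $0$.)
   Context: For integers $0\le m\le n$, $$c_{m,n}=\alpha\sum_{j=0}^{n-1}\sum_{k=0}^{m}\left[\binom{m}{k}\binom{n-1-j}{k}-\binom{n}{k}\binom{m-1-j}{k}\right](\alpha^2\ell)^k(1-\alpha)^{n+m-1-j-2k},$$ with the convention $\binom{a}{k}=0$ unless $0\le k\le a$. $F_1$ is Appell's hypergeometric function $$F_1(a;b_1,b_2;c;u,v)=\sum_{k=0}^\infty\sum_{l=0}^\infty\frac{(a)_{k+l}(b_1)_k(b_2)_l}{(c)_{k+l}}\frac{u^k}{k!}\frac{v^l}{l!},\qquad (x)_k=\prod_{i=0}^{k-1}(x+i);$$ when $a$ is a nonpositive integer the double series is a finite sum, defined for all $u,v$. *)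

(* Defs.v *)
From HB Require Import structures.
From mathcomp Require Import all_boot all_order all_algebra.
From mathcomp Require Import all_classical all_reals all_analysis.
Import Order.TTheory GRing.Theory Num.Theory.
Import numFieldNormedType.Exports.

Set Implicit Arguments.
Unset Strict Implicit.
Unset Printing Implicit Defensive.

Local Open Scope ring_scope.

(* Binomial coefficient with integer upper argument, equal to 0 unless
   0 <= k <= a; unlike ['C(a - b, k)] on nat, it is 0 (and not ['C(0, k)])
   when the upper argument is a negative difference. *)
Definition binz (a : int) (k : nat) : nat :=
  if a is Posz p then 'C(p, k) else 0%N.

(* The power of [1 - alpha] is an integer power: its exponent can be negative,
   but only for indices at which the bracket vanishes. *)
Definition c_ (R : realType) (alpha ell : R) (m n : nat) : R :=
  alpha * \sum_(0 <= j < n) \sum_(0 <= k < m.+1)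
    ((binz m%:Z k)%:R * (binz (n%:Z - 1 - j%:Z) k)%:R
      - (binz n%:Z k)%:R * (binz (m%:Z - 1 - j%:Z) k)%:R)
    * (alpha ^+ 2 * ell) ^+ k
    * (1 - alpha) ^ (n%:Z + m%:Z - 1 - j%:Z - 2 * k%:Z).

Definition R_ (R : realType) (alpha ell : R) (m : nat) : R :=
  c_ alpha ell m m.+1 / alpha.

Definition pochhammer (R : realType) (x : R) (k : nat) : R :=
  \prod_(0 <= i < k) (x + i%:R).

(* The double series is read as an iterated sum. When [a] is a nonpositive
   integer, [pochhammer a (k + l)] vanishes for large [k + l], so that all the
   partial sums are eventually constant, for all [u] and [v]. *)
Definition appellF1 (R : realType) (a b1 b2 c u v : R) : R :=
  \big[+%R/0]_(0 <= k <oo) \big[+%R/0]_(0 <= l <oo)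
    (pochhammer a (k + l) * pochhammer b1 k * pochhammer b2 l
       / pochhammer c (k + l)
     * (u ^+ k / k`!%:R) * (v ^+ l / l`!%:R)).

(* Main.v *)
(* Writing b = 1 - alpha and w = alpha / b, one has b^-1 = 1 + w, so b^-j expands
   binomially in w.  The sum over j then collapses by the Chu-Vandermonde
   identity sum_j C(j, l) C(n-1-j, k) = C(n, k+l+1), and the resulting double sum
   in k and l is n F_1(1-n; -m, 1; 2) term by term.  For n = m+1 the two
   double sums merge termwise into that of F_1(-m; -(m+1), 2; 2). *)
Require Import Defs.
From HB Require Import structures.
From mathcomp Require Import all_boot all_order all_algebra.
From mathcomp Require Import all_classical all_reals all_analysis.
From mathcomp Require Import ring zify.
Import Order.TTheory GRing.Theory Num.Theory.
Import numFieldNormedType.Exports.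
Local Open Scope ring_scope.

(** Sort the subsets of size [k + l + 1] of [{0, ..., n-1}] by their element [j] that has exactly
    [l] members of the subset below it. The induction uses Pascal's rule on the second factor, with
    [k] kept general. *)
Lemma sum_bin_bin (n k l : nat) :
  (\sum_(0 <= j < n) 'C(j, l) * 'C(n - 1 - j, k) = 'C(n, (k + l).+1))%N.
Proof.
elim: n k => [|n IHn] k; first by rewrite big_geq // bin0n.
rewrite big_nat_recr //= subn1 /= subnn.
case: k => [|k].
  rewrite bin0 muln1 binS -IHn; congr (_ + _)%N.
  by apply: eq_big_nat => j _; rewrite !bin0.
rewrite bin0n muln0 addn0 addSn binS -addSn -!IHn -big_split /=.
apply: eq_big_nat => j /andP[_ lt_jn].
by rewrite -mulnDr -binS -subnDA add1n subnS prednK // subn_gt0.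
Qed.

(** For [j >= m] the upper argument is negative and [binz] is 0, even at [k = 0]; the terms left
    form the previous sum for [m]. *)
Lemma sum_bin_binz (m n k l : nat) : (m <= n)%N ->
  (\sum_(0 <= j < n) 'C(j, l) * binz (m%:Z - 1 - j%:Z) k = 'C(m, (k + l).+1))%N.
Proof.
move=> le_mn; rewrite (big_cat_nat (n := m)) //= -sum_bin_bin.
rewrite [X in (_ + X)%N]big_nat_cond [X in (_ + X)%N]big1 ?addn0; last first.
  move=> j /andP[/andP[le_mj _] _].
  have -> : m%:Z - 1 - j%:Z = Negz (j - m) by rewrite NegzE; lia.
  by rewrite /= muln0.
apply: eq_big_nat => j /andP[_ lt_jm].
by have -> : m%:Z - 1 - j%:Z = (m - 1 - j)%N%:Z by lia.
Qed.

Section Pochhammer.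
Variable R : realType.
Implicit Types (a b c x u v : R) (k l m n : nat).

Lemma pochhammerS x k : pochhammer x k.+1 = pochhammer x k * (x + k%:R).
Proof. by rewrite /pochhammer big_nat_recr. Qed.

Lemma pochhammer_oppn n k :
  pochhammer (- n%:R : R) k = (-1) ^+ k * (n ^_ k)%:R.
Proof.
elim: k => [|k IHk]; first by rewrite /pochhammer big_geq // ffactn0 mulr1.
rewrite pochhammerS IHk ffactnSr exprS natrM.
(* The subtraction [n - k] truncates when [n < k], but then [n ^_ k] is already 0. *)
case: (leqP k n) => [le_kn|lt_nk]; first by rewrite natrB //; ring.
by rewrite ffact_small // !(mulr0, mul0r).
Qed.

Lemma pochhammer_oppn_small n k :
  (n < k)%N -> pochhammer (- n%:R : R) k = 0.
Proof. by move=> lt_nk; rewrite pochhammer_oppn ffact_small // mulr0. Qed.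

Lemma pochhammer1 k : pochhammer (1 : R) k = k`!%:R.
Proof.
elim: k => [|k IHk]; first by rewrite /pochhammer big_geq.
by rewrite pochhammerS IHk factS mulnC natrM -nat1r.
Qed.

Lemma pochhammer2 k : pochhammer (2 : R) k = k.+1`!%:R.
Proof.
elim: k => [|k IHk]; first by rewrite /pochhammer big_geq.
by rewrite pochhammerS IHk [in RHS]factS mulnC natrM -natrD add2n.
Qed.

Lemma series_trunc (f : nat -> R) N :
  (forall k, (N <= k)%N -> f k = 0) ->
  \big[+%R/0]_(0 <= k <oo) f k = \sum_(0 <= k < N) f k.
Proof.
move=> f0; apply: lim_near_cst => //.
near=> n.
have le_Nn : (N <= n)%N by near: n; exact: nbhs_infty_ge.
rewrite (big_cat_nat (n := N)) //= [X in _ + X]big_nat_cond.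
rewrite [X in _ + X]big1 ?addr0 //.
by move=> k /andP[/andP[+ _] _]; exact: f0.
Unshelve. all: by end_near. Qed.

(** The bounds [K] and [L] stay free so that different Appell functions can be summed over one
    common rectangle. *)
Lemma appellF1_trunc a b1 b2 c u v K L :
  (forall k l, (K <= k)%N || (L <= l)%N ->
     pochhammer a (k + l) * pochhammer b1 k = 0) ->
  appellF1 a b1 b2 c u v =
  \sum_(0 <= k < K) \sum_(0 <= l < L)
    (pochhammer a (k + l) * pochhammer b1 k * pochhammer b2 l
       / pochhammer c (k + l)
     * (u ^+ k / k`!%:R) * (v ^+ l / l`!%:R)).
Proof.
move=> F0; rewrite /appellF1.
under eq_fun => N.
  under eq_bigr => k _.
    rewrite (@series_trunc _ L); last first.
      by move=> l le_Ll; rewrite F0 ?le_Ll ?orbT // !mul0r.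
    over.
  over.
rewrite (@series_trunc _ K) // => k le_Kk.
by apply: big1 => l _; rewrite F0 ?le_Kk // !mul0r.
Qed.

End Pochhammer.

Lemma c_expand (R : realType) (ell alpha : R) (m n : nat) :
  1 - alpha != 0 -> (m <= n)%N ->
  let w := alpha / (1 - alpha) in
  c_ alpha ell m n = alpha * (1 - alpha) ^+ (m + n - 1) *
    \sum_(0 <= k < m.+1) \sum_(0 <= l < n)
      (('C(m, k) * 'C(n, (k + l).+1))%:R - ('C(n, k) * 'C(m, (k + l).+1))%:R)
      * ((w ^+ 2 * ell) ^+ k * w ^+ l).
Proof.
move=> b0 le_mn w; rewrite /c_ -mulrA; congr (alpha * _).
rewrite exchange_big_nat /= big_distrr /=; apply: eq_big_nat => k _.
have bV : (1 - alpha)^-1 = w + 1 by rewrite /w; field.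
(* The range of [l] is padded with zero terms up to [n], so that it no longer depends on [j] and the
   two sums can be exchanged. *)
have binom j : (j < n)%N ->
    (1 - alpha) ^- j = \sum_(0 <= l < n) 'C(j, l)%:R * w ^+ l.
  move=> lt_jn; rewrite -exprVn bV exprD1n -(big_mkord xpredT
    (fun i => w ^+ i *+ 'C(j, i))) [RHS](@big_cat_nat _ _ _ j.+1) //=.
  rewrite [X in _ = _ + X]big_nat_cond [X in _ = _ + X]big1 ?addr0; last first.
    by move=> l /andP[/andP[lt_jl _] _]; rewrite bin_small // mul0r.
  by apply: eq_big_nat => l _; rewrite mulr_natl.
transitivity (\sum_(0 <= j < n) \sum_(0 <= l < n)
    (1 - alpha) ^+ (m + n - 1) * ((w ^+ 2 * ell) ^+ k * w ^+ l) *
    (('C(m, k) * ('C(j, l) * binz (n%:Z - 1 - j%:Z) k))%:R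
     - ('C(n, k) * ('C(j, l) * binz (m%:Z - 1 - j%:Z) k))%:R)).
  apply: eq_big_nat => j /andP[_ lt_jn].
  have -> : (1 - alpha) ^ (n%:Z + m%:Z - 1 - j%:Z - 2 * k%:Z) =
      (1 - alpha) ^+ (m + n - 1) * (1 - alpha) ^- j / (1 - alpha) ^+ 2 ^+ k.
    (* Since [j < n] forces [n > 0], the natural subtraction [m + n - 1] is exact. *)
    have -> : n%:Z + m%:Z - 1 - j%:Z - 2 * k%:Z =
      (m + n - 1)%N%:Z + - j%:Z + - (2 * k)%N%:Z by lia.
    by rewrite !expfzDr // -!exprnN -!exprnP exprM.
  rewrite binom // big_distrr /= big_distrl big_distrr /=.
  apply: eq_big_nat => l _; rewrite !natrM /w !exprMn !exprVn.
  by field; rewrite !expf_neq0.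
rewrite exchange_big_nat /= big_distrr /=; apply: eq_big_nat => l _.
rewrite -big_distrr /= [X in _ * X]sumrB -!natr_sum -!big_distrr /=.
by rewrite !sum_bin_binz //; ring.
Qed.

Lemma natr_fact_neq0 (R : realType) n : n`!%:R != 0 :> R.
Proof. by rewrite pnatr_eq0 -lt0n fact_gt0. Qed.

Lemma bin_natr (R : realType) n k : 'C(n, k)%:R = (n ^_ k)%:R / k`!%:R :> R.
Proof. by rewrite -bin_ffact natrM mulfK // natr_fact_neq0. Qed.

(** The terms vanish for [k > m] because of [(-m)_k], and for [k + l >= n] because of [(1-n)_(k+l)].
    Either bound may limit [k]: the disjunction lets the rectangle of [c_expand] also serve with [m]
    and [n] exchanged. *)
Lemma appellF1_bin (R : realType) (u w : R) (m n K L : nat) :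
  (m < K)%N || (n <= K)%N -> (n <= L)%N ->
  n%:R * appellF1 (1 - n%:R) (- m%:R) 1 2 u (- w) =
  \sum_(0 <= k < K) \sum_(0 <= l < L)
    ('C(m, k) * 'C(n, (k + l).+1))%:R * (u ^+ k * w ^+ l).
Proof.
case: n => [_ _|n le_K le_L].
  (* At [n = 0] the first parameter is 1 and the series in [l] need not terminate; the factor 0 in
     front disposes of it. *)
  rewrite mul0r big1 // => k _; rewrite big1 // => l _.
  by rewrite bin0n muln0 mul0r.
have -> : 1 - n.+1%:R = - n%:R :> R by rewrite -nat1r; ring.
rewrite (@appellF1_trunc _ _ _ _ _ _ _ K L); last first.
  move=> k l /orP[le_k|le_l]; last first.
    by rewrite pochhammer_oppn_small ?mul0r //; lia.
  case/orP: le_K => le_K.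
    by rewrite (@pochhammer_oppn_small _ m) ?mulr0 //; lia.
  by rewrite pochhammer_oppn_small ?mul0r //; lia.
rewrite big_distrr; apply: eq_big_nat => k _ /=.
rewrite big_distrr; apply: eq_big_nat => l _ /=.
rewrite pochhammer1 pochhammer2 !pochhammer_oppn natrM !bin_natr ffactSS natrM.
rewrite (exprNn w) exprD.
(* The signs from [(1-n)_(k+l)], [(-m)_k] and [(-w)^l] are paired into squares, which equal 1. *)
transitivity (((-1) ^+ k * (-1) ^+ k) * ((-1) ^+ l * (-1) ^+ l) *
  ((m ^_ k)%:R / k`!%:R * (n.+1%:R * (n ^_ (k + l))%:R / (k + l).+1`!%:R)
  * (u ^+ k * w ^+ l))).
  by field; rewrite !natr_fact_neq0.
by rewrite -!exprMn !mulrNN !mulr1 !expr1n !mul1r.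
Qed.

(** After multiplication by [k + l + 1], both products are multiples of [C(m+1, k) C(m, k+l)], with
    cofactors [m + 1 - k] and [m - (k + l)] that differ by [l + 1]. *)
Lemma bin_succ_diff (R : realType) (m k l : nat) :
  ('C(m, k) * 'C(m.+1, (k + l).+1))%:R - ('C(m.+1, k) * 'C(m, (k + l).+1))%:R =
  'C(m.+1, k)%:R * 'C(m, k + l)%:R * l.+1%:R / (k + l).+1%:R :> R.
Proof.
(* When [m < k + l] everything vanishes; otherwise [m - (k + l)] is an exact subtraction. *)
case: (ltnP m (k + l)) => [lt_m|le_m].
  rewrite !(@bin_small _ (k + l)) ?(@bin_small _ (k + l).+1) //; try lia.
  by rewrite !muln0 subrr mulr0 !mul0r.
apply: (@mulIf _ (k + l).+1%:R); first by rewrite pnatr_eq0.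
rewrite mulfVK ?pnatr_eq0 // mulrBl -!natrM.
(* Absorption in the second binomial releases a factor [m + 1], which the first takes up through
   [(m+1) C(m, k) = (m+1-k) C(m+1, k)]. *)
have e1 : ('C(m, k) * 'C(m.+1, (k + l).+1) * (k + l).+1
    = 'C(m.+1, k) * 'C(m, k + l) * (m.+1 - k))%N.
  by rewrite -mulnA [(_ * (k + l).+1)%N]mulnC -mul_bin_diag mulnCA mulnA
    (mul_bin_down m.+1 k) /=; ring.
have e2 : ('C(m.+1, k) * 'C(m, (k + l).+1) * (k + l).+1
    = 'C(m.+1, k) * 'C(m, k + l) * (m - (k + l)))%N.
  by rewrite -mulnA [(_ * (k + l).+1)%N]mulnC mul_bin_left; ring.
rewrite e1 e2; move: ('C(m.+1, k) * 'C(m, k + l))%N => x.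
rewrite !natrM -mulrBr -natrB; last by lia.
by have -> : (m.+1 - k - (m - (k + l)) = l.+1)%N by lia.
Qed.

(** The factor [l + 1] of [bin_succ_diff] is [(2)_l / l!], which is why the parameter [b2] becomes
    2; the remaining [(k + l + 1)!] is [(2)_(k+l)]. *)
Lemma appellF1_bin_succ (R : realType) (u w : R) (m : nat) :
  appellF1 (- m%:R) (- m.+1%:R) 2 2 u (- w) =
  \sum_(0 <= k < m.+1) \sum_(0 <= l < m.+1)
    (('C(m, k) * 'C(m.+1, (k + l).+1))%:R
     - ('C(m.+1, k) * 'C(m, (k + l).+1))%:R) * (u ^+ k * w ^+ l).
Proof.
rewrite (@appellF1_trunc _ _ _ _ _ _ _ m.+1 m.+1); last first.
  by move=> k l le_m; rewrite pochhammer_oppn_small ?mul0r //; lia.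
apply: eq_big_nat => k _; apply: eq_big_nat => l _.
rewrite bin_succ_diff !pochhammer2 !pochhammer_oppn !bin_natr !factS.
rewrite !(natrM _ _.+1) (exprNn w) exprD.
transitivity (((-1) ^+ k * (-1) ^+ k) * ((-1) ^+ l * (-1) ^+ l) *
  ((m.+1 ^_ k)%:R / k`!%:R * ((m ^_ (k + l))%:R / (k + l)`!%:R) * l.+1%:R
   / (k + l).+1%:R * (u ^+ k * w ^+ l))).
  by field; rewrite !natr_fact_neq0 -natrD nat1r pnatr_eq0.
by rewrite -!exprMn !mulrNN !mulr1 !expr1n !mul1r.
Qed.

Theorem proposition4 (R : realType) (ell alpha : R)
  (ell_gt0 : 0 < ell) (ell_le1 : ell <= 1)
  (alpha_gt0 : 0 < alpha) (alpha_lt1 : alpha < 1) :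
  let u := (alpha / (1 - alpha)) ^+ 2 * ell in
  let v := - (alpha / (1 - alpha)) in
  forall m n : nat, (m < n)%N ->
    c_ alpha ell m n =
      alpha * (1 - alpha) ^+ (m + n - 1) *
        (n%:R * appellF1 (1 - n%:R) (- m%:R) 1 2 u v
         - (if m == 0%N then 0
            else m%:R * appellF1 (1 - m%:R) (- n%:R) 1 2 u v))
    /\ R_ alpha ell m =
      (1 - alpha) ^+ (2 * m) * appellF1 (- m%:R) (- (m.+1)%:R) 2 2 u v.
Proof.
move=> u v m n lt_mn.
have b0 : 1 - alpha != 0 by rewrite subr_eq0 gt_eqF.
split.
  rewrite c_expand ?(ltnW lt_mn) //; congr (_ * _).
  have -> : (if m == 0%N then 0
      else m%:R * appellF1 (1 - m%:R) (- n%:R) 1 2 u v) =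
      m%:R * appellF1 (1 - m%:R) (- n%:R) 1 2 u v.
    by case: eqP => // ->; rewrite mul0r.
  rewrite !(@appellF1_bin _ _ _ _ _ m.+1 n) ?ltnSn ?leqnSn ?orbT // 1?ltnW //.
  rewrite -sumrB; apply: eq_big_nat => k _.
  by rewrite -sumrB; apply: eq_big_nat => l _; rewrite mulrBl.
rewrite /R_ c_expand // addnS subn1 /= addnn -mul2n.
rewrite -(mulrA alpha) mulrC mulKf ?gt_eqF //.
by rewrite appellF1_bin_succ.
Qed.
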